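(* Let $0 \le k \le n$ be integers and let $L$ be a multiplicative sublattice of $\mathbb{Z}^n$ of co-rank $k$. Then every $\mathbb{Z}$-basis of $L$ forms the rows of an $(n-k) \times n$ matrix $M$ with exactly $n-k$ distinct non-zero columns (that is, the set of non-zero vectors occurring as columns of $M$ has exactly $n-k$ elements).
   Context: $\mathbb{Z}^n$ is the ring of $n$-tuples of integers with componentwise addition and multiplication. A sublattice of $\mathbb{Z}^n$ is a $\mathbb{Z}$-submodule $L \subseteq \mathbb{Z}^n$; its co-rank is $n - \operatorname{rank}_{\mathbb{Z}} L$. A sublattice $L$ is multiplicative if $u \cdot v \in L$ for all $u,v \in L$ (it is not required to contain the identity $(1,\dots,1)$). *)

(* Defs.v *)
From HB Require Import structures.
From mathcomp Require Import all_boot all_order all_algebra.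
Set Implicit Arguments.
Unset Strict Implicit.
Unset Printing Implicit Defensive.
Import GRing.Theory.
Local Open Scope ring_scope.

(* int^o, the regular Z-module, is convertible to int; it is what gives Zn n
   its Z-module structure in addition to its componentwise ring structure. *)
Notation Zn n := {ffun 'I_n -> int^o}.

Definition Zcomb (V : lmodType int) (s : seq V) (a : 'I_(size s) -> int) : V :=
  \sum_(i < size s) a i *: s`_i.

Definition Zfree (V : lmodType int) (s : seq V) : Prop :=
  forall a : 'I_(size s) -> int, Zcomb a = 0 -> forall i, a i = 0.

Definition Zbasis (V : lmodType int) (L : {pred V}) (s : seq V) : Prop :=
  Zfree s /\ forall v, v \in L <-> exists a : 'I_(size s) -> int, v = Zcomb a.

(* The largest size of a Z-linearly independent family in L; it is not defined
   through bases, so that all bases of L have this size is a theorem. *)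
Definition Zrank (V : lmodType int) (L : {pred V}) (r : nat) : Prop :=
  (exists s : seq V, [/\ {subset s <= L}, Zfree s & size s = r]) /\
  (forall s : seq V, {subset s <= L} -> Zfree s -> (size s <= r)%N).

Definition sublattice (n : nat) (L : {pred Zn n}) : Prop := submod_closed L.

Definition multiplicative_sublattice (n : nat) (L : {pred Zn n}) : Prop :=
  sublattice L /\ GRing.mulr_2closed L.

(* Stated as r + k = n rather than k = n - r to avoid truncated subtraction. *)
Definition corank (n : nat) (L : {pred Zn n}) (k : nat) : Prop :=
  exists2 r, Zrank L r & (r + k = n)%N.

Definition matrix_rows (m n : nat) (M : 'M[int]_(m, n)) : seq (Zn n) :=
  [seq [ffun j => M i j] | i <- enum 'I_m].

Definition distinct_nonzero_columns (m n : nat) (M : 'M[int]_(m, n)) :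
    seq 'cV[int]_m :=
  undup [seq c <- [seq col j M | j <- enum 'I_n] | c != 0].

(* Main.v *)
(** Let [r] be the rank of [L] and [d] the number of distinct non-zero columns.
    If [v] and [u] lie in [L], so does [u_j *: v - u * v], which vanishes
    wherever [v] does and also at [j], but not at an [i] with [v_i <> 0] and
    [u_i <> u_j].  Iterating this, each of [d]
    representative coordinates carries a vector of [L] that is non-zero there
    and zero at the other representatives; these [d] vectors are independent,
    so [d <= r].  Conversely, if [d < r], some non-trivial combination of the
    rows kills all the columns, which contradicts the freeness of the basis. *)
Require Import Defs.
From HB Require Import structures.
From mathcomp Require Import all_boot all_order all_algebra.
Set Implicit Arguments.
Unset Strict Implicit.
Unset Printing Implicit Defensive.
Import GRing.Theory.
Local Open Scope ring_scope.

(** In a Smith decomposition [A = P D Q], the row of index [q] of [D] lies below the diagonal and is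
    zero, so the row of index [q] of the inverse of [P] kills [A]; it is non-zero because [P] is
    invertible. *)
Lemma int_left_kernel (p q : nat) (A : 'M[int]_(p, q)) :
  (q < p)%N -> exists2 a : 'rV[int]_p, a != 0 & a *m A = 0.
Proof.
move=> ltqp.
have [P Pu [Q _ [d _ ->]]] := int_Smith_normal_form A.
exists (row (Ordinal ltqp) (invmx P)).
  apply/eqP => row0; have := congr1 (mulmx^~ P) row0.
  rewrite -row_mul mulVmx // mul0mx => /rowP/(_ (Ordinal ltqp)).
  by rewrite !mxE eqxx.
rewrite -row_mul -mulmxA mulKmx // row_mul.
suff -> : row (Ordinal ltqp) (\matrix_(i < p, j < q) (d`_i *+ (i == j :> nat)))
          = 0 by rewrite mul0mx.
by apply/rowP=> j; rewrite !mxE /= gtn_eqF.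
Qed.

(** If [s] were longer than [t], a left kernel vector of the matrix expressing [s] in terms of [t]
    would be a non-trivial relation on [s]. *)
Lemma Zfree_span_size_le (V : lmodType int) (s t : seq V) :
  Zfree s ->
  {in s, forall v, exists a : 'I_(size t) -> int, v = Zcomb a} ->
  (size s <= size t)%N.
Proof.
move=> free_s span_t; rewrite leqNgt; apply/negP=> lt_ts.
have [C sC] := fin_all_exists (fun i : 'I_(size s) =>
  span_t _ (mem_nth 0 (ltn_ord i))).
have [a /eqP a0 aC] := int_left_kernel (\matrix_(i, j) C i j) lt_ts.
apply: a0; apply/rowP=> i; rewrite mxE.
apply: (free_s (a 0)) i; rewrite /Zcomb.
under eq_bigr do rewrite sC /Zcomb scaler_sumr.
rewrite exchange_big big1 //= => j _.
under eq_bigr do rewrite scalerA.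
rewrite -scaler_suml; have -> : \sum_i a 0 i * C i j = 0.
  by move/rowP/(_ j): aC; rewrite !mxE; under eq_bigr do rewrite mxE.
exact: scale0r.
Qed.

Lemma Zbasis_mem (V : lmodType int) (L : {pred V}) (b : seq V) :
  Zbasis L b -> {subset b <= L}.
Proof.
move=> [_ span_b] v /(nthP 0) [i lti <-]; apply/span_b.
exists (fun j => (j == Ordinal lti)%:R).
rewrite /Zcomb (bigD1 (Ordinal lti)) //= eqxx scale1r big1 ?addr0 // => j.
by move/negPf->; rewrite scale0r.
Qed.

Lemma Zbasis_size (V : lmodType int) (L : {pred V}) (b : seq V) (r : nat) :
  Zrank L r -> Zbasis L b -> size b = r.
Proof.
move=> [[s [sL free_s <-]] max_r] bL; have [free_b span_b] := bL.
apply/eqP; rewrite eqn_leq; apply/andP; split.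
  exact: max_r (Zbasis_mem bL) free_b.
by apply: Zfree_span_size_le => // v /sL /span_b.
Qed.

Lemma mult_sublattice_isolate (n : nat) (L : {pred Zn n}) (j : 'I_n)
    (s : seq 'I_n) :
  multiplicative_sublattice L ->
  (exists2 w, w \in L & w j != 0) ->
  {in s, forall j', exists2 u, u \in L & u j != u j'} ->
  exists v, [/\ v \in L, v j != 0 & {in s, forall j', v j' = 0}].
Proof.
move=> [[L0 Llin] Lmul] [w wL wj].
elim: s => [|j' s IHs] sep; first by exists w.
have [|v [vL vj vs]] := IHs; first by move=> i si; apply: sep; rewrite inE si orbT.
have [u uL uj] := sep j' (mem_head _ _).
(* This is [v] times [u j' - u], expanded so as to stay in [L] even when the constant vector [u j']
   does not lie there. *)
exists (u j' *: v - u * v); split.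
- rewrite addrC -scaleN1r; apply: (Llin); first exact: Lmul.
  by rewrite -[_ *: v]addr0; apply: Llin.
- by rewrite !ffunE -mulrBl mulf_neq0 // subr_eq0 eq_sym.
- move=> i; rewrite inE => /predU1P [->|/vs vi0]; rewrite !ffunE.
    exact: subrr.
  by rewrite vi0 scaler0 mulr0 subr0.
Qed.

(** On the coordinates in [J] the family is a diagonal matrix with non-zero diagonal, so evaluating
    a relation at one of them isolates one coefficient. *)
Lemma Zfree_isolated (n : nat) (J : seq 'I_n) (v : 'I_n -> Zn n) :
  uniq J ->
  {in J, forall j, v j j != 0} ->
  {in J &, forall j j', j != j' -> v j j' = 0} ->
  Zfree [seq v j | j <- J].
Proof.
move=> J_uniq v_diag v_off a a0 i.
have lti : (i < size J)%N by rewrite -(size_map v).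
pose j0 := tnth (in_tuple J) (Ordinal lti).
have sJ (l : 'I_(size [seq v j | j <- J])) : (l < size J)%N.
  by rewrite -(size_map v).
have nthJ (l : 'I_(size [seq v j | j <- J])) : nth j0 J l \in J.
  exact: mem_nth.
have /eqP := congr1 (fun w : Zn n => w (nth j0 J i)) a0.
rewrite /Zcomb sum_ffunE ffunE (bigD1 i) //= big1 ?addr0 => [|l neq_li].
  rewrite (nth_map j0) // ffunE mulf_eq0 (negPf (v_diag _ (nthJ i))) orbF.
  by move/eqP.
by rewrite (nth_map j0) // ffunE v_off ?scaler0 // nth_uniq.
Qed.

Theorem theorem6 (n k : nat) (L : {pred Zn n}) :
  (k <= n)%N ->
  multiplicative_sublattice L ->
  corank L k ->
  forall b : seq (Zn n), Zbasis L b ->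
  exists M : 'M[int]_(n - k, n),
    matrix_rows M = b /\ size (distinct_nonzero_columns M) = (n - k)%N.
Proof.
move=> _ L_mult [r rankL rkn] b bL.
have [free_b span_b] := bL.
have {rkn} <- : size b = (n - k)%N by rewrite (Zbasis_size rankL bL) -rkn addnK.
pose M : 'M[int]_(size b, n) := \matrix_(i, j) b`_i j.
exists M; split.
  apply: (@eq_from_nth _ 0); rewrite size_map size_enum_ord // => i lti.
  rewrite (nth_map (Ordinal lti)) ?size_enum_ord //.
  apply/ffunP=> j; rewrite ffunE mxE.
  by rewrite (nth_ord_enum _ (Ordinal lti)).
set D := distinct_nonzero_columns M.
have D_uniq : uniq D by apply: undup_uniq.
have mem_D c : (c \in D) = (c != 0) && (c \in [seq col j M | j <- enum 'I_n]).
  by rewrite mem_undup mem_filter.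
apply/eqP; rewrite eqn_leq; apply/andP; split.
  have : {subset D <= [seq col j M | j <- enum 'I_n]}.
    by move=> c; rewrite mem_D => /andP [].
  (* [J] holds one representative coordinate for each distinct non-zero column. *)
  case/subset_mapP=> J _ DJ; rewrite DJ size_map.
  have DJ_uniq : uniq [seq col j M | j <- J] by rewrite -DJ.
  have J_uniq := map_uniq DJ_uniq.
  have col_inj : {in J &, injective (fun j => col j M)}.
    move=> j j' /(nthP j) [i lti <-] /(nthP j) [i' lti' <-] /eqP.
    rewrite -!(nth_map _ (col j M) (fun j => col j M)) // nth_uniq ?size_map //.
    by move/eqP->.
  have entry_neq (c c' : 'cV[int]_(size b)) : c != c' ->
      exists i, c i 0 != c' i 0.
    move=> cc'; apply/existsP; apply: contra_neqT cc' => /existsPn ecc'.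
    by apply/colP=> i; apply/eqP; rewrite -[_ == _]negbK.
  have [v vP] : exists v : 'I_n -> Zn n, forall j, j \in J ->
      [/\ v j \in L, v j j != 0 & {in rem j J, forall j', v j j' = 0}].
    apply: (fin_all_exists (P := fun j v => j \in J -> [/\ v \in L, v j != 0 &
       {in rem j J, forall j', v j' = 0}])) => j.
    (* Outside [J] the value 0 is a mere default. *)
    have [Jj|] := boolP (j \in J); last by exists 0.
    have [|j'|v] := mult_sublattice_isolate (j := j) (s := rem j J) L_mult.
    - have : col j M \in D by rewrite DJ (map_f (fun j => col j M)).
      rewrite mem_D => /andP [/entry_neq [i]]; rewrite !mxE => bi _.
      by exists b`_i; first exact: (Zbasis_mem bL) (mem_nth _ _).
    (* Distinct columns differ in some row, and that basis vector separates [j] from [j']. *)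
    - rewrite mem_rem_uniq // inE => /andP [neq Jj'].
      have /entry_neq [i] : col j M != col j' M.
        by apply: contra_neq neq => /col_inj->.
      rewrite !mxE => bi.
      by exists b`_i; first exact: (Zbasis_mem bL) (mem_nth _ _).
    - by exists v.
  have [_ max_r] := rankL.
  rewrite -(size_map v) [X in (_ <= X)%N](Zbasis_size rankL bL); apply: max_r.
    by move=> _ /mapP [j /vP [vL _ _] ->].
  apply: Zfree_isolated => // [j /vP [] //|j j' /vP [_ _ v0] Jj' neq].
  by apply: v0; rewrite mem_rem_uniq // inE eq_sym neq.
rewrite leqNgt; apply/negP=> lt_Db.
have [a /eqP a0 aD] :=
  int_left_kernel (\matrix_(i < size b, l < size D) D`_l i 0) lt_Db.
apply: a0; apply/rowP=> i; rewrite mxE.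
apply: (free_b (a 0)) i; apply/ffunP=> j.
rewrite /Zcomb sum_ffunE ffunE.
(* Coordinate [j] of the combination is [a] times column [j], which is either zero or a member of
   [D], hence killed by [a]. *)
have -> : \sum_(i < size b) (a 0 i *: b`_i : Zn n) j = (a *m col j M) 0 0.
  by rewrite mxE; apply: eq_bigr => i _; rewrite ffunE !mxE.
have [->|Mj0] := eqVneq (col j M) 0; first by rewrite mulmx0 mxE.
have lt_jD : (index (col j M) D < size D)%N.
  by rewrite index_mem mem_D Mj0 (map_f (fun j => col j M)) ?mem_enum.
have := congr1 (fun x : 'rV_(size D) => x 0 (Ordinal lt_jD)) aD.
rewrite [RHS]mxE => <-; rewrite 2!mxE; apply: eq_bigr => i _.
by rewrite [in RHS]mxE nth_index // -index_mem.
Qed.
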